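(* Let $G$ be a connected graph with $n\ge 2$ vertices. Then $$\Phi(G)\le 1,$$ with equality if and only if $G$ is transmission regular.
   Context: All graphs are finite and simple. For a connected graph $G$, $d(u,v)$ denotes the distance between vertices $u,v$ (number of edges of a shortest path). The transmission of a vertex $v$ is $\sigma(v)=\sum_{u\in V(G)} d(v,u)$. $G$ is transmission regular if $\sigma(u)=\sigma(v)$ for all vertices $u,v$ of $G$. The invariant $\Phi$ is defined by $$\Phi(G)=\frac{\left(\sum_{u\in V(G)}\sigma(u)\right)^2}{n\sum_{u\in V(G)}\sigma(u)^2}.$$ *)

(* Defs.v *)
From mathcomp Require Import all_boot all_order all_algebra.

Set Implicit Arguments.
Unset Strict Implicit.
Unset Printing Implicit Defensive.

Import GRing.Theory Num.Theory.

(* A finite simple graph is a symmetric irreflexive adjacency relation [e] on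
   a finite type of vertices [T]. *)

Definition connected_graph (T : finType) (e : rel T) : Prop :=
  forall x y : T, connect e x y.

(* [p] lists the vertices after [x], so the path [x :: p] has [k] edges. *)
Definition has_path_of_length (T : finType) (e : rel T) (x y : T) (k : nat)
    : bool :=
  [exists p : k.-tuple T,
     [&& path e x p, uniq (x :: p) & last x p == y]].

(* The least length of a path from [x] to [y].  A path has at most [#|T| - 1]
   edges, so searching the lengths below [#|T|] is exhaustive; when [x] and [y]
   are not connected, [find] returns the junk value [#|T|]. *)
Definition dist (T : finType) (e : rel T) (x y : T) : nat :=
  find (has_path_of_length e x y) (iota 0 #|T|).

Definition transmission (T : finType) (e : rel T) (v : T) : nat :=
  \sum_(u : T) dist e v u.

Definition transmission_regular (T : finType) (e : rel T) : Prop :=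
  forall u v : T, transmission e u = transmission e v.

Local Open Scope ring_scope.

Definition Phi (R : realFieldType) (T : finType) (e : rel T) : R :=
  (\sum_(u : T) (transmission e u)%:R) ^+ 2
  / (#|T|%:R * \sum_(u : T) (transmission e u)%:R ^+ 2).

(* Main.v *)
Require Import Defs.
From mathcomp Require Import all_boot all_order all_algebra.
From mathcomp Require Import ring.
Import Order.TTheory GRing.Theory Num.Theory.
Local Open Scope ring_scope.

(** The inequality is Cauchy-Schwarz for the vector of transmissions against
    the all-ones vector. By Lagrange's identity ([sum_sqr_diff]), twice the gap
    between the denominator and the numerator of [Phi] is the sum of
    [(sigma u - sigma v) ^+ 2] over all pairs of vertices. This sum is
    nonnegative, and it vanishes exactly when all transmissions agree.

    To pass from the gap to the quotient, the denominator must be positive.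
    Distinct vertices are at positive distance ([dist_gt0]), so in a graph with
    at least two vertices every transmission is positive. *)

(** Lagrange's identity for the vectors [a] and [(1, ..., 1)]. *)
Lemma sum_sqr_diff (R : comNzRingType) (T : finType) (a : T -> R) :
  \sum_u \sum_v (a u - a v) ^+ 2
  = 2 * (#|T|%:R * \sum_u a u ^+ 2 - (\sum_u a u) ^+ 2).
Proof.
have row u : \sum_v (a u - a v) ^+ 2
    = #|T|%:R * a u ^+ 2 - 2 * (\sum_v a v) * a u + \sum_v a v ^+ 2.
  under eq_bigr => v _ do rewrite sqrrB.
  by rewrite big_split sumrB /= sumr_const sumrMnl -mulr_sumr; ring.
under eq_bigr => u _ do rewrite row.
by rewrite big_split sumrB /= -!mulr_sumr sumr_const; ring.
Qed.

Lemma sum_sqr_diff_eq0 (R : realDomainType) (T : finType) (a : T -> R) :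
  \sum_u \sum_v (a u - a v) ^+ 2 = 0 <-> forall u v, a u = a v.
Proof.
split=> [sum0 u v | a_const]; last first.
  by rewrite big1 // => u _; rewrite big1 // => v _;
     rewrite (a_const u v) subrr expr0n.
have row_ge0 w : 0 <= \sum_v (a w - a v) ^+ 2.
  by apply: sumr_ge0 => ? _; apply: sqr_ge0.
have row0 : \sum_w (a u - a w) ^+ 2 = 0.
  exact: psumr_eq0P (fun w _ => row_ge0 w) sum0 _ isT.
have /eqP : (a u - a v) ^+ 2 = 0.
  exact: psumr_eq0P (fun w _ => sqr_ge0 (a u - a w)) row0 _ isT.
by rewrite sqrf_eq0 subr_eq0 => /eqP.
Qed.

(** The search for the least length can stop at [0] only on the empty path,
    which ends where it starts. *)
Lemma dist_gt0 (T : finType) (e : rel T) (x y : T) :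
  x != y -> (0 < dist e x y)%N.
Proof.
move=> neq_xy; rewrite /dist.
have: (0 < #|T|)%N by apply/card_gt0P; exists x.
case: #|T| => //= n _; case: ifP => // /existsP[p].
by rewrite tuple0 /= (negPf neq_xy).
Qed.

Lemma transmission_gt0 (T : finType) (e : rel T) (v : T) :
  (2 <= #|T|)%N -> (0 < transmission e v)%N.
Proof.
move=> n_ge2.
have /card_gt0P[u neq_uv] : (0 < #|predC1 v|)%N.
  by rewrite cardC1 -subn1 subn_gt0.
rewrite /transmission (bigD1 u) //= addn_gt0 dist_gt0 //.
by rewrite eq_sym.
Qed.

Theorem theorem1 (R : realFieldType) (T : finType) (e : rel T)
    (e_sym : symmetric e) (e_irrefl : irreflexive e)
    (e_conn : connected_graph e) (n_ge2 : (2 <= #|T|)%N) :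
  Phi R e <= 1 /\ (Phi R e = 1 <-> transmission_regular e).
Proof.
pose s u : R := (transmission e u)%:R.
have lagrange := @sum_sqr_diff R T s.
have n_gt0 : (0 < #|T|)%N := ltnW n_ge2.
have den_gt0 : 0 < #|T|%:R * \sum_u s u ^+ 2.
  have /card_gt0P[x _] := n_gt0.
  rewrite mulr_gt0 ?ltr0n // (bigD1 x) //= ltr_pwDl //.
    by rewrite exprn_gt0 // ltr0n transmission_gt0.
  by apply: sumr_ge0 => u _; apply: sqr_ge0.
split.
  rewrite /Phi ler_pdivrMr // mul1r -subr_ge0 -(@pmulr_rge0 _ 2) // -lagrange.
  by apply: sumr_ge0 => u _; apply: sumr_ge0 => v _; apply: sqr_ge0.
have Phi_eq1 : Phi R e = 1 <-> \sum_u \sum_v (s u - s v) ^+ 2 = 0.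
  rewrite lagrange /Phi; split=> [/divr1_eq -> | /eqP].
    by rewrite subrr mulr0.
  rewrite mulf_eq0 pnatr_eq0 subr_eq0 /= => /eqP <-.
  by rewrite divff // gt_eqF.
rewrite Phi_eq1 sum_sqr_diff_eq0 /transmission_regular.
split=> s_const u v; last by rewrite /s (s_const u v).
by apply/eqP; rewrite -(eqr_nat R); apply/eqP/s_const.
Qed.
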